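(* Let $\mathbf q_2^*=(q_{1,2}^*,\dots,q_{N_f,2}^* )$ be the optimal caching probability in the regime $\lambda_u/\lambda_2\to\infty$, i.e. the maximizer of $$P_{\rm off}^{\infty}(\mathbf q_2)=\sum_{f=1}^{N_f}\frac{p_f\,q_{f,2}}{\mathcal C_{1,\gamma_0}+\mathcal C_{2,\gamma_0}+(\mathcal C_{3,\gamma_0}+1)\,q_{f,2}}$$ subject to $\sum_{f=1}^{N_f}q_{f,2}\le N_c$ and $0\le q_{f,2}\le1$ for all $f$. Then for any $f$ with $q_{f,2}^*,q_{f+1,2}^*\in(0,1)$, the difference $q_{f,2}^*-q_{f+1,2}^*$ increases with $\lambda_{12}$ and increases with $P_{12}$. That is, with all other parameters fixed, on the set of values of $\lambda_{12}$ (respectively of $P_{12}$) for which both $q_{f,2}^*$ and $q_{f+1,2}^*$ lie in $(0,1)$, $q_{f,2}^*-q_{f+1,2}^*$ is an increasing function of $\lambda_{12}$ (respectively of $P_{12}$).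
   Context: Parameters: $\lambda_{12}>0$ (ratio of macro-BS density to helper density), $P_{12}>0$ (ratio of transmit powers), $B_{12}>0$ (ratio of association bias factors), $\gamma_0>0$, $\alpha>2$, integer $M_1\ge1$, $M_2=1$, $M_{12}=M_1/M_2$. $N_f$ is the number of files, $N_c$ is the cache capacity, a positive integer with $N_c\le N_f$, and $p_f=f^{-\delta}/\sum_{n=1}^{N_f}n^{-\delta}$ with $\delta>0$. ${}_2F_1$ is the Gauss hypergeometric function (analytically continued to the negative real axis), $\Gamma$ the Gamma function, and $$\mathcal C_{1,\gamma_0}=\lambda_{12}(P_{12}B_{12})^{2/\alpha}\,{}_2F_1\Big[-\tfrac2\alpha,M_1;1-\tfrac2\alpha;-\tfrac{\gamma_0}{M_{12}B_{12}}\Big],\quad \mathcal C_{2,\gamma_0}=\frac{\Gamma(1-\frac2\alpha)\Gamma(M_2+\frac2\alpha)}{\Gamma(M_2)}\gamma_0^{2/\alpha},$$ $$\mathcal C_{3,\gamma_0}={}_2F_1\Big[-\tfrac2\alpha,M_2;1-\tfrac2\alpha;-\gamma_0\Big]-\mathcal C_{2,\gamma_0}-1.$$ The maximizer is given explicitly by $$q_{f,2}^*=\left[\frac{\sqrt{\mathcal C_{1,\gamma_0}+\mathcal C_{2,\gamma_0}}}{\sqrt{\nu}\,(\mathcal C_{3,\gamma_0}+1)}\sqrt{p_f}-\frac{\mathcal C_{1,\gamma_0}+\mathcal C_{2,\gamma_0}}{\mathcal C_{3,\gamma_0}+1}\right]_0^1,$$ where $[x]_0^1=\max\{\min\{x,1\},0\}$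 and $\nu>0$ is such that $\sum_{f=1}^{N_f}q_{f,2}^*=N_c$. *)

(* Defs.v *)
From HB Require Import structures.
From mathcomp Require Import all_boot all_order all_algebra.
From mathcomp Require Import all_classical all_reals all_analysis.

Set Implicit Arguments.
Unset Strict Implicit.
Unset Printing Implicit Defensive.

Import Order.TTheory GRing.Theory Num.Theory.
Import numFieldNormedType.Exports.

Local Open Scope classical_set_scope.
Local Open Scope ring_scope.

(* Euler's integral; meaningful for s > 0. *)
Definition Gamma (R : realType) (s : R) : R :=
  \int[@lebesgue_measure R]_(t in `]0, +oo[) (t `^ (s - 1) * expR (- t)).

Definition rising (R : realType) (a : R) (n : nat) : R :=
  \prod_(i < n) (a + i%:R).

Definition hyp2F1_coef (R : realType) (a b c : R) (n : nat) : R :=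
  rising a n * rising b n / (rising c n * n`!%:R).

Definition analytic_at (R : realType) (F : R -> R) (x : R) : Prop :=
  exists a : nat -> R, \forall h \near 0, pseries a h @ \oo --> F (x + h).

(* F agrees with the Gauss series on the unit interval and is real-analytic on
   ]-oo, 1[.  As ]-oo, 1[ is connected, this determines F on ]-oo, 1[, where
   it is the restriction of the analytic continuation to C \ [1, +oo[. *)
Definition is_hyp2F1 (R : realType) (a b c : R) (F : R -> R) : Prop :=
  (forall z : R, `|z| < 1 -> pseries (hyp2F1_coef a b c) z @ \oo --> F z) /\
  (forall x : R, x < 1 -> analytic_at F x).

(* Meaningful for z < 1 and c not a nonpositive integer; the values of the
   chosen function on [1, +oo[ are arbitrary. *)
Definition hyp2F1 (R : realType) (a b c : R) : R -> R :=
  xget (fun=> 0) [set F : R -> R | is_hyp2F1 a b c F].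

Definition C1 (R : realType) (alpha gamma0 B12 : R) (M1 M2 : nat)
    (lambda12 P12 : R) : R :=
  lambda12 * (P12 * B12) `^ (2 / alpha) *
  hyp2F1 (- (2 / alpha)) M1%:R (1 - 2 / alpha)
    (- (gamma0 / (M1%:R / M2%:R * B12))).

Definition C2 (R : realType) (alpha gamma0 : R) (M2 : nat) : R :=
  Gamma (1 - 2 / alpha) * Gamma (M2%:R + 2 / alpha) / Gamma (M2%:R : R) *
  gamma0 `^ (2 / alpha).

Definition C3 (R : realType) (alpha gamma0 : R) (M2 : nat) : R :=
  hyp2F1 (- (2 / alpha)) M2%:R (1 - 2 / alpha) (- gamma0)
  - C2 alpha gamma0 M2 - 1.

(* Zipf law; files are numbered from 0, so file f : 'I_N has rank f.+1. *)
Definition zipf (R : realType) (N : nat) (delta : R) (f : 'I_N) : R :=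
  f.+1%:R `^ (- delta) / \sum_(n < N) n.+1%:R `^ (- delta).

Definition Poff_infty (R : realType) (N : nat)
    (alpha gamma0 B12 delta : R) (M1 M2 : nat) (lambda12 P12 : R)
    (q : 'rV[R]_N) : R :=
  \sum_(f < N) zipf delta f * q 0 f /
    (C1 alpha gamma0 B12 M1 M2 lambda12 P12 + C2 alpha gamma0 M2
     + (C3 alpha gamma0 M2 + 1) * q 0 f).

Definition feasible (R : realType) (N Nc : nat) (q : 'rV[R]_N) : Prop :=
  \sum_(f < N) q 0 f <= Nc%:R /\ (forall f, 0 <= q 0 f <= 1).

Definition optimal_caching (R : realType) (N Nc : nat)
    (alpha gamma0 B12 delta : R) (M1 M2 : nat) (lambda12 P12 : R)
    (q : 'rV[R]_N) : Prop :=
  feasible Nc q /\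
  forall q' : 'rV[R]_N, feasible Nc q' ->
    Poff_infty alpha gamma0 B12 delta M1 M2 lambda12 P12 q' <=
    Poff_infty alpha gamma0 B12 delta M1 M2 lambda12 P12 q.

(* Main.v *)
(** With [A = C1 + C2] and [D = C3 + 1], the objective is the sum of
    [p_f q_f / (A + D q_f)]. Only [A] depends on [lambda12] and [P12], and it is
    strictly increasing in both because [2F1(-s, m; 1-s; x) >= 1] for [x <= 0].
    The sign of [D] need not be computed: if [D <= 0], then either the objective
    has a pole, hence no maximizer, or it is convex, so that no maximizer is
    interior at two files of different popularity. If [D > 0], exchanging mass
    between files shows that [A + D q_f = w sqrt p_f] at interior files, and the
    gap is [w (sqrt p_f - sqrt p_f') / D]. If [w] did not increase with [A],
    every [q_f] would decrease, and the budget would not be exhausted.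

    The hypergeometric function is only characterized by analytic continuation.
    Its existence on ]-oo, 1[ and the bound come from Euler's integral, expanded
    under the integral sign around every point; its uniqueness is the identity
    theorem. *)
Require Import Defs.
From HB Require Import structures.
From mathcomp Require Import all_boot all_order all_algebra.
From mathcomp Require Import all_classical all_reals all_analysis.
From mathcomp Require Import measurable_realfun ring lra zify.
Import Order.TTheory GRing.Theory Num.Theory.
Import numFieldNormedType.Exports.
Local Open Scope classical_set_scope.
Local Open Scope ring_scope.

(** Let [t] tend to 0. This replaces limits both in the first-order optimality conditions and in the
    comparison of power series coefficients. *)
Lemma le0_of_small (R : realType) (X Y e : R) : 0 < e ->
  (forall t, 0 < t <= e -> X <= Y * t) -> X <= 0.
Proof.
move=> e0 h; rewrite leNgt; apply/negP => X0.
(* This choice keeps [Y * t] at most [X / 2]. *)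
pose t := Num.min e (X / (2 * (`|Y| + 1))).
have Y1 : 0 < 2 * (`|Y| + 1) by have := normr_ge0 Y; lra.
have t0 : 0 < t by rewrite lt_min e0 divr_gt0.
have te : t <= e by rewrite ge_min lexx.
have : X <= Y * t by apply: h; rewrite t0 te.
have : t * (2 * (`|Y| + 1)) <= X by rewrite -ler_pdivlMr// ge_min lexx orbT.
have := ler_norm Y; nra.
Qed.

(** * Optimal caching *)

Section Offloading.
Context {R : realType} {N : nat} {Nc : nat} {p : 'I_N -> R}.
Hypotheses (p_gt0 : forall i, 0 < p i) (Nc_gt0 : (0 < Nc)%N).

(** The objective with weights and constants abstracted: [Poff_infty] is the instance
    [p = zipf delta], [A = C1 + C2], [D = C3 + 1], by unfolding alone. *)
Definition fracsum (A D : R) (q : 'rV[R]_N) : R :=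
  \sum_(i < N) p i * q 0 i / (A + D * q 0 i).

Definition maximizes (A D : R) (q : 'rV[R]_N) : Prop :=
  feasible Nc q /\
  forall q', feasible Nc q' -> fracsum A D q' <= fracsum A D q.

Lemma frac_incr (A D x t : R) : A + D * x != 0 -> A + D * (x + t) != 0 ->
  (x + t) / (A + D * (x + t)) =
  x / (A + D * x) + A * t / ((A + D * x) * (A + D * (x + t))).
Proof. by move=> h1 h2; field; rewrite h1 h2. Qed.

Lemma den_gt0 (A D x : R) : 0 < A -> 0 < A + D -> 0 <= x <= 1 ->
  0 < A + D * x.
Proof.
move=> A0 AD /andP[x0 x1]; have [D0|D0] := lerP 0 D; nra.
Qed.

(** Moving mass [t] from file [j] to file [i] keeps the budget, so the gain at [i] cannot exceed the
    loss at [j]. By [frac_incr] both are exact multiples of [A * t], which cancels. *)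
Lemma maximizes_exchange {A D : R} {q : 'rV[R]_N} {i j : 'I_N} (t : R) :
  maximizes A D q -> 0 < A -> 0 < A + D -> i != j -> 0 < t ->
  q 0 i + t <= 1 -> 0 <= q 0 j - t ->
  p i * ((A + D * q 0 j) * (A + D * (q 0 j - t))) <=
  p j * ((A + D * q 0 i) * (A + D * (q 0 i + t))).
Proof.
move=> [[qs qb] qmax] A0 AD ij t0 it jt.
pose q' : 'rV[R]_N := \row_k (if k == i then q 0 i + t else
                   if k == j then q 0 j - t else q 0 k).
have ji : j != i by rewrite eq_sym.
have q'i : q' 0 i = q 0 i + t by rewrite mxE eqxx.
have q'j : q' 0 j = q 0 j - t by rewrite mxE (negbTE ji) eqxx.
have q'k k : k != i -> k != j -> q' 0 k = q 0 k.
  by move=> ki kj; rewrite mxE (negbTE ki) (negbTE kj).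
have split2 (F : 'I_N -> R) :
    \sum_k F k = F i + (F j + \sum_(k | (k != i) && (k != j)) F k).
  by rewrite (bigD1 i)//= (bigD1 j).
have qbi := qb i; have qbj := qb j.
have feas : feasible Nc q'.
  split.
    rewrite split2 q'i q'j (eq_bigr (fun k => q 0 k)).
      by move: qs; rewrite split2; lra.
    by move=> k /andP[ki kj]; rewrite q'k.
  move=> k; have [->|ki] := eqVneq k i; first by rewrite q'i; lra.
  have [->|kj] := eqVneq k j; first by rewrite q'j; lra.
  by rewrite q'k.
have := qmax _ feas.
rewrite /fracsum !split2 q'i q'j.
rewrite (eq_bigr (fun k => p k * q 0 k / (A + D * q 0 k))); last first.
  by move=> k /andP[ki kj]; rewrite q'k.
have gi : 0 < A + D * q 0 i by exact: den_gt0.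
have gj : 0 < A + D * q 0 j by exact: den_gt0.
have gi' : 0 < A + D * (q 0 i + t) by apply: den_gt0 => //; lra.
have gj' : 0 < A + D * (q 0 j - t) by apply: den_gt0 => //; lra.
rewrite -!(mulrA (p _)) !frac_incr ?gt_eqF// mulrN mulNr.
set gi2 := (A + D * q 0 i) * _; set gj2 := (A + D * q 0 j) * _ => h.
have gi2_gt0 : 0 < gi2 by exact: mulr_gt0.
have gj2_gt0 : 0 < gj2 by exact: mulr_gt0.
have {}h : p i * (A * t / gi2) <= p j * (A * t / gj2) by lra.
have At : 0 < A * t by exact: mulr_gt0.
have : p i * (A * t) * gj2 <= p j * (A * t) * gi2.
  by move: h; rewrite 2![_ * (A * t / _)]mulrA ler_pdivrMr// mulrAC ler_pdivlMr.
by rewrite -[in X in _ -> X](ler_pM2r At); lra.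
Qed.

(** First-order condition, obtained from the exchange inequality as [t] tends to 0. *)
Lemma maximizes_kkt {A D : R} {q : 'rV[R]_N} {i j : 'I_N} :
  maximizes A D q -> 0 < A -> 0 < A + D -> q 0 i < 1 -> 0 < q 0 j ->
  p i * (A + D * q 0 j) ^+ 2 <= p j * (A + D * q 0 i) ^+ 2.
Proof.
move=> qmax A0 AD qi qj; have [->//|ij] := eqVneq i j.
rewrite -subr_le0.
(* The factor of [t] collects the linear terms of the expanded exchange inequality. *)
apply: (@le0_of_small _ _ (D * (p i * (A + D * q 0 j) + p j * (A + D * q 0 i)))
  (Num.min (1 - q 0 i) (q 0 j))); first by rewrite lt_min subr_gt0 qi.
move=> t /andP[t0]; rewrite le_min => /andP[ti tj].
have := maximizes_exchange t qmax A0 AD ij t0.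
have -> : q 0 i + t <= 1 by lra.
have -> : 0 <= q 0 j - t by lra.
by move=> /(_ isT isT); lra.
Qed.

Lemma maximizes_gain_gt0 {A D : R} {q : 'rV[R]_N} (i : 'I_N) :
  0 < A -> maximizes A D q -> 0 < A + D.
Proof.
move=> A0 [_ qmax]; rewrite ltNge; apply/negP => AD.
have D0 : D < 0 by lra.
(* The pole [-A/D] lies in ]0, 1]: the objective is unbounded just below. *)
pose k := 2 + `|fracsum A D q| * (- D) / p i.
have k2 : 2 <= k.
  by rewrite lerDl divr_ge0 ?mulr_ge0 ?oppr_ge0 ?(ltW (p_gt0 i)) ?(ltW D0).
(* At [x] the denominator is [A / k], so file [i] alone contributes [p i * (k - 1) / - D]; [k] makes
   this exceed the absolute value of the supposed maximum. *)
pose x := A / - D * (1 - k^-1).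
have k0 : 0 < k by lra.
have Di : 0 < (- D)^-1 by rewrite invr_gt0; lra.
have kV : 0 < k^-1 <= 1 by rewrite invr_gt0 k0 invf_le1//; lra.
have x01 : 0 <= x <= 1.
  have : 0 < A / - D <= 1 by rewrite divr_gt0//= ?ler_pdivrMr; lra.
  rewrite /x; nra.
pose q' : 'rV[R]_N := \row_l (if l == i then x else 0).
have sum1 (F : 'I_N -> R) : (forall l, l != i -> F l = 0) ->
    \sum_l F l = F i.
  by move=> F0; rewrite (bigD1 i)//= big1 ?addr0.
have feas : feasible Nc q'.
  split => [|l].
    rewrite sum1 ?mxE ?eqxx; last by move=> l li; rewrite mxE (negbTE li).
    have : (1 : R) <= Nc%:R by rewrite ler1n.
    by case/andP: x01; lra.
  by rewrite mxE; case: ifP => // _; rewrite lexx ler01.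
have := qmax _ feas.
rewrite {1}/fracsum sum1; last first.
  by move=> l li; rewrite mxE (negbTE li) mulr0 mul0r.
rewrite mxE eqxx /x => h; have := le_trans h (ler_norm _).
have -> : p i * (A / - D * (1 - k^-1)) / (A + D * (A / - D * (1 - k^-1))) =
    p i * (k - 1) / - D.
  have -> : A + D * (A / - D * (1 - k^-1)) = A / k.
    by field; rewrite (lt_eqF D0) (gt_eqF k0).
  by field; rewrite (lt_eqF D0) (gt_eqF k0) (gt_eqF A0).
rewrite ler_pdivrMr ?oppr_gt0// /k.
have -> : p i * (2 + `|fracsum A D q| * - D / p i - 1) =
    p i + `|fracsum A D q| * - D by field; rewrite gt_eqF.
by have := p_gt0 i; lra.
Qed.

(** For [D < 0] each term is strictly convex, so a finite transfer from [j] to [i] beats its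
    first-order estimate, against [maximizes_kkt]. For [D = 0] the objective is linear and the
    transfer favours the more popular file. *)
Lemma maximizes_slope_gt0 {A D : R} {q : 'rV[R]_N} {i j : 'I_N} :
  0 < A -> p j < p i -> maximizes A D q -> 0 < q 0 i < 1 -> 0 < q 0 j < 1 ->
  0 < D.
Proof.
move=> A0 pij qmax qi qj; rewrite ltNge; apply/negP => D0.
have AD := maximizes_gain_gt0 i A0 qmax.
have ij : i != j by apply: contraTneq pij => ->; rewrite ltxx.
pose t := Num.min (1 - q 0 i) (q 0 j).
have t0 : 0 < t by rewrite lt_min; lra.
have ti : q 0 i + t <= 1.
  by have : t <= 1 - q 0 i by [rewrite ge_min lexx]; lra.
have tj : 0 <= q 0 j - t.
  by have : t <= q 0 j by [rewrite ge_min lexx orbT]; lra.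
have := maximizes_exchange t qmax A0 AD ij t0 ti tj.
have : p j * (A + D * q 0 i) ^+ 2 <= p i * (A + D * q 0 j) ^+ 2.
  by apply: (maximizes_kkt qmax) => //; lra.
have gi : 0 < A + D * q 0 i by apply: den_gt0 => //; lra.
have gj : 0 < A + D * q 0 j by apply: den_gt0 => //; lra.
have pi0 := p_gt0 i; have pj0 := p_gt0 j.
have [D0'|D0'] := eqVneq D 0.
  rewrite D0' !mul0r !addr0 => _; rewrite ler_pM2r ?mulr_gt0//.
  by rewrite leNgt pij.
have Dlt : 0 < - D by rewrite oppr_gt0 lt_neqAle D0'.
have : 0 < - D * t * (p i * (A + D * q 0 j) + p j * (A + D * q 0 i)).
  by apply: mulr_gt0; [exact: mulr_gt0|apply: addr_gt0; exact: mulr_gt0].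
lra.
Qed.

(** Each term strictly increases with its [q 0 i], so leftover budget could be spent on a file that
    is not yet saturated. *)
Lemma maximizes_tight {A D : R} {q : 'rV[R]_N} {i : 'I_N} :
  0 < A -> 0 < D -> maximizes A D q -> q 0 i < 1 ->
  Nc%:R <= \sum_(k < N) q 0 k.
Proof.
move=> A0 D0 [[qs qb] qmax] qi1; rewrite leNgt; apply/negP => slack.
have qi := qb i.
pose t := Num.min (1 - q 0 i) (Nc%:R - \sum_(k < N) q 0 k).
have t0 : 0 < t by rewrite lt_min; lra.
have ti : q 0 i + t <= 1.
  by have : t <= 1 - q 0 i by [rewrite ge_min lexx]; lra.
have ts : t <= Nc%:R - \sum_(k < N) q 0 k by rewrite ge_min lexx orbT.
pose q' : 'rV[R]_N := \row_k (if k == i then q 0 i + t else q 0 k).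
have q'i : q' 0 i = q 0 i + t by rewrite mxE eqxx.
have q'k k : k != i -> q' 0 k = q 0 k by move=> ki; rewrite mxE (negbTE ki).
have feas : feasible Nc q'.
  split.
    rewrite (bigD1 i)//= q'i (eq_bigr (fun k => q 0 k)); last first.
      by move=> k; exact: q'k.
    by move: ts; rewrite (bigD1 i)//=; lra.
  move=> k; have [->|ki] := eqVneq k i; first by rewrite q'i; lra.
  by rewrite q'k.
have := qmax _ feas.
rewrite /fracsum (bigD1 i)//= [leRHS](bigD1 i)//= q'i.
rewrite (eq_bigr (fun k => p k * q 0 k / (A + D * q 0 k))); last first.
  by move=> k ki; rewrite q'k.
have AD : 0 < A + D by lra.
have gi : 0 < A + D * q 0 i by exact: den_gt0.
have gi' : 0 < A + D * (q 0 i + t) by apply: den_gt0 => //; lra.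
rewrite lerD2r -!mulrA frac_incr ?gt_eqF// mulrDr gerDl.
apply/negP; rewrite -ltNge.
by rewrite !(mulr_gt0, invr_gt0).
Qed.

(* With [w] the common value of [(A + D q_k) / sqrt p_k] over interior indices,
   every [q_k] is [w sqrt p_k / D - A / D] clipped to [[0, 1]]. *)
Lemma maximizes_waterlevel {A D : R} {q : 'rV[R]_N} {i : 'I_N} :
  0 < A -> 0 < D -> maximizes A D q -> 0 < q 0 i < 1 ->
  exists w : R, forall k,
    (0 < q 0 k -> A + D * q 0 k <= w * Num.sqrt (p k)) /\
    (q 0 k < 1 -> w * Num.sqrt (p k) <= A + D * q 0 k).
Proof.
move=> A0 D0 qmax /andP[qi0 qi1].
have AD : 0 < A + D by lra.
have sp k : 0 < Num.sqrt (p k) by rewrite sqrtr_gt0.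
have g k : 0 < A + D * q 0 k by apply: den_gt0 => //; case: qmax => -[].
have root k l : p k * (A + D * q 0 l) ^+ 2 <= p l * (A + D * q 0 k) ^+ 2 ->
    Num.sqrt (p k) * (A + D * q 0 l) <= Num.sqrt (p l) * (A + D * q 0 k).
  rewrite -{1}(sqr_sqrtr (ltW (p_gt0 k))) -{1}(sqr_sqrtr (ltW (p_gt0 l))).
  by rewrite -!exprMn ler_sqr// nnegrE mulr_ge0// ltW.
(* The level is read off at the interior file [i], which can be compared with any other file in both
   directions. *)
exists ((A + D * q 0 i) / Num.sqrt (p i)) => k.
rewrite mulrAC ler_pdivlMr// ler_pdivrMr//; split => qk.
  have := root _ _ (maximizes_kkt qmax A0 AD qi1 qk); lra.
have := root _ _ (maximizes_kkt qmax A0 AD qk qi0); lra.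
Qed.

Lemma maximizes_gap_lt {A A' D : R} {q q' : 'rV[R]_N} {i j : 'I_N} :
  0 < A -> A < A' -> p j < p i -> maximizes A D q -> maximizes A' D q' ->
  0 < q 0 i < 1 -> 0 < q 0 j < 1 -> 0 < q' 0 i < 1 -> 0 < q' 0 j < 1 ->
  q 0 i - q 0 j < q' 0 i - q' 0 j.
Proof.
move=> A0 AA' pij qmax qmax' qi qj qi' qj'.
have A'0 : 0 < A' by lra.
have D0 := maximizes_slope_gt0 A0 pij qmax qi qj.
have [w wq] := maximizes_waterlevel A0 D0 qmax qi.
have [w' wq'] := maximizes_waterlevel A'0 D0 qmax' qi'.
have ww' : w < w'.
  rewrite ltNge; apply/negP => w'w.
  (* Here [D * q' 0 k <= w' * sqrt (p k) - A' < w * sqrt (p k) - A <= D * q 0 k]. *)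
  have lt_of_lt k : 0 < q' 0 k -> q 0 k < 1 -> q' 0 k < q 0 k.
    move=> /(wq' k).1 h1 /(wq k).2 h2.
    have : w' * Num.sqrt (p k) <= w * Num.sqrt (p k).
      by rewrite ler_wpM2r ?sqrtr_ge0.
    by rewrite -(ltr_pM2l D0); lra.
  (* A violation would put [q' 0 k] above 0 and [q 0 k] below 1, which is the case just excluded. *)
  have le_qq' k : q' 0 k <= q 0 k.
    rewrite leNgt; apply/negP => lt_k.
    have [/andP[q0 _] /andP[_ q'1]] := (qmax.1.2 k, qmax'.1.2 k).
    by have := lt_of_lt k (le_lt_trans q0 lt_k) (lt_le_trans lt_k q'1); lra.
  have : Nc%:R <= \sum_k q' 0 k.
    by apply: (maximizes_tight A'0 D0 qmax' (i := i)); case/andP: qi'.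
  have : \sum_k q' 0 k < \sum_k q 0 k.
    rewrite (bigD1 i)//= [ltRHS](bigD1 i)//= ltr_leD ?ler_sum//.
    by apply: lt_of_lt; lra.
  by have := qmax.1.1; lra.
have e k : 0 < q 0 k < 1 -> A + D * q 0 k = w * Num.sqrt (p k).
  move=> /andP[/(wq k).1 h1 /(wq k).2 h2]; lra.
have e' k : 0 < q' 0 k < 1 -> A' + D * q' 0 k = w' * Num.sqrt (p k).
  move=> /andP[/(wq' k).1 h1 /(wq' k).2 h2]; lra.
have : Num.sqrt (p j) < Num.sqrt (p i) by rewrite ltr_sqrt.
rewrite -(ltr_pM2l D0).
have := e _ qi; have := e _ qj; have := e' _ qi'; have := e' _ qj'; nra.
Qed.
End Offloading.
Arguments fracsum {R N} p A D q.
Arguments maximizes {R N} Nc p A D q.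

(** * The hypergeometric function *)

Section NegativeBinomial.
Context {R : realType}.
Implicit Types (z : R) (k n : nat).

(** Pascal's rule: multiplying by [1 - z] lowers [k] by one, up to a boundary term. *)
Lemma negbin_sumS k n z :
  (1 - z) * (\sum_(i < n) 'C(i + k.+1, k.+1)%:R * z ^+ i) =
  \sum_(i < n) 'C(i + k, k)%:R * z ^+ i - 'C(n + k, k.+1)%:R * z ^+ n.
Proof.
elim: n => [|n ih].
  by rewrite !big_ord0 mulr0 add0n bin_small// mul0r subr0.
rewrite !big_ord_recr/= mulrDr ih addnS addSn !binS natrD exprS; ring.
Qed.

Lemma negbin_sum0 n z :
  (1 - z) * (\sum_(i < n) 'C(i + 0, 0)%:R * z ^+ i) = 1 - z ^+ n.
Proof.
elim: n => [|n ih]; first by rewrite big_ord0 mulr0 subrr.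
by rewrite big_ord_recr/= mulrDr ih bin0 exprS; ring.
Qed.

(** Induction on [k]: for [z >= 0] the boundary term has a favourable sign and is dropped. *)
Lemma negbin_sum_le {k n z} : 0 <= z < 1 ->
  \sum_(i < n) 'C(i + k, k)%:R * z ^+ i <= (1 - z) ^- k.+1.
Proof.
move=> /andP[z0 z1]; have z1' : 0 < 1 - z by rewrite subr_gt0.
elim: k => [|k ih].
  rewrite expr1 -[leRHS]mul1r ler_pdivlMr// mulrC negbin_sum0.
  by rewrite gerBl exprn_ge0.
rewrite exprSr invfM ler_pdivlMr// mulrC negbin_sumS (le_trans _ ih)//.
by rewrite gerBl mulr_ge0// exprn_ge0.
Qed.

(** The absolute partial sums are bounded by [negbin_sum_le], so the series converges and its terms
    vanish in the limit. *)
Lemma negbin_cvg0 {k z} : `|z| < 1 ->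
  'C(n + k, k)%:R * z ^+ n @[n --> \oo] --> 0.
Proof.
move=> z1; apply: cvg_series_cvg_0; apply: normed_cvg.
apply: nondecreasing_is_cvgn.
  by apply: nondecreasing_series => i _ _; exact: normr_ge0.
exists ((1 - `|z|) ^- k.+1) => _ [n _ <-].
rewrite /= /normed_series_of/= /series/= big_mkord.
under eq_bigr do rewrite normrM normrX ger0_norm//.
by apply: negbin_sum_le; rewrite normr_ge0.
Qed.

Lemma negbin_cvg {k z} : `|z| < 1 ->
  \sum_(i < n) 'C(i + k, k)%:R * z ^+ i @[n --> \oo] --> (1 - z) ^- k.+1.
Proof.
move=> z1; have z1' : 1 - z != 0.
  by rewrite subr_eq0 gt_eqF// (le_lt_trans (ler_norm _)).
have solve (u v : nat -> R) (l : R) : (forall n, (1 - z) * u n = v n) ->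
    v @ \oo --> l -> u @ \oo --> l / (1 - z).
  move=> uv vl; rewrite (_ : u = fun n => v n / (1 - z)).
    by apply: cvgMl.
  by apply/funext => n; rewrite -uv mulrC mulKf.
elim: k => [|k ih].
  rewrite expr1 -[X in _ --> X]mul1r; apply: solve (negbin_sum0 ^~ z) _.
  rewrite -[X in _ --> X]subr0; apply: cvgB; first exact: cvg_cst.
  exact: cvg_expr.
rewrite exprSr invfM; apply: solve (negbin_sumS k ^~ z) _.
rewrite -[X in _ --> X]subr0; apply: cvgB => //.
apply/norm_cvg0P.
(* The boundary term is dominated by the general term of the series for [k.+1], again by Pascal's
   rule. *)
apply: (@squeeze_cvgr _ _ _ _ (cst 0)
  (fun n => `|'C(n + k.+1, k.+1)%:R * z ^+ n|)).
- apply: nearW => n; rewrite normr_ge0/= !normrM ler_wpM2r//.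
  rewrite !ger0_norm// ler_nat.
  by rewrite addnS binS leq_addr.
- exact: cvg_cst.
- by apply/norm_cvg0P; exact: negbin_cvg0.
Qed.

End NegativeBinomial.

Lemma dominated_Rintegral {d : measure_display} {T : measurableType d}
    {R : realType} {mu : {measure set T -> \bar R}} {D : set T}
    {f_ : nat -> T -> R} {f : T -> R} (g : T -> R) :
  measurable D -> (forall n, measurable_fun D (f_ n)) ->
  (forall x, D x -> f_ ^~ x @ \oo --> f x) ->
  mu.-integrable D (EFin \o g) ->
  (forall n x, D x -> `|f_ n x| <= g x) ->
  mu.-integrable D (EFin \o f) /\
  (\int[mu]_(x in D) f_ n x)%R @[n --> \oo] --> (\int[mu]_(x in D) f x)%R.
Proof.
move=> mD mf_ f_f ig fg.
have [|||||intf _ cvgf] := @dominated_convergence _ _ R mu D mD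
    (fun n => EFin \o f_ n) (EFin \o f) (EFin \o g).
- by move=> n; apply/measurable_EFinP.
- by apply/measurable_EFinP; apply: measurable_fun_cvg f_f.
- by apply: aeW => x Dx; apply: cvg_EFin; [exact: nearW|exact: f_f].
- exact: ig.
- by apply: aeW => x n Dx; rewrite lee_fin fg.
split => //; apply: fine_cvg.
by rewrite /Rintegral fineK//; exact: integrable_fin_num.
Qed.

(** * Euler's integral and its Taylor expansions *)

Section LaplaceIntegral.
Context {R : realType}.
Notation mu := (@lebesgue_measure R).
Notation D := (`[0, +oo[%classic : set R).

(** The exponential density [r * expR (- r * y)] has total mass 1; divide by [r]. *)
Lemma integral_expR {r : R} : 0 < r ->
  mu.-integrable D (fun y => (expR (- r * y))%:E) /\
  (\int[mu]_(y in D) expR (- r * y))%R = r^-1.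
Proof.
move=> r0; have := integrable_exponential_pdf r0.
have := integral_exponential_pdf r0.
have pdfE : EFin \o exponential_pdf r =
    (fun y => r%:E * (expR (- r * y))%:E)%E \_ D.
  by apply/funext => y /=; rewrite /exponential_pdf !patchE; case: ifP.
rewrite [X in X = 1%E -> _](_ : _ =
  \int[mu]_x (EFin \o exponential_pdf r) x)%E//.
have mD : measurable D := measurable_itv _.
rewrite pdfE -integral_mkcond => i1 i2.
have {}i2 : mu.-integrable D (fun y => r%:E * (expR (- r * y))%:E)%E.
  by apply/integrable_mkcond.
have ie : mu.-integrable D (fun y => (expR (- r * y))%:E).
  rewrite (_ : (fun y => _) =
      fun y => ((r^-1)%:E * (r%:E * (expR (- r * y))%:E))%E).
    by apply: integrableZl.
  by apply/funext => y; rewrite -!EFinM mulKf ?gt_eqF.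
split => //.
rewrite integralZl// in i1.
apply: (mulfI (lt0r_neq0 r0)); rewrite mulfV ?gt_eqF//.
apply: EFin_inj.
by rewrite EFinM /Rintegral fineK//; exact: integrable_fin_num.
Qed.
Implicit Types (s x y h r C : R) (k n : nat).

Lemma integrable_le_expR {r C} {f : R -> R} : 0 < r -> measurable_fun D f ->
  (forall y, 0 <= y -> `|f y| <= C * expR (- r * y)) ->
  mu.-integrable D (EFin \o f).
Proof.
move=> r0 mf fC.
have iC : mu.-integrable D (fun y => C%:E * (expR (- r * y))%:E)%E.
  by apply: integrableZl => //; have [] := integral_expR r0.
apply: le_integrable iC => //; first exact/measurable_EFinP.
move=> y; rewrite /= in_itv/= andbT => y0.
by rewrite lee_fin (le_trans (fC _ y0))// ler_norm.
Qed.

Lemma Rintegral_sum {n} {c : nat -> R} {g : nat -> R -> R} :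
  (forall i, mu.-integrable D (EFin \o g i)) ->
  mu.-integrable D (EFin \o (fun y => \sum_(i < n) c i * g i y)) /\
  (\int[mu]_(y in D) \sum_(i < n) c i * g i y)%R =
    \sum_(i < n) c i * (\int[mu]_(y in D) g i y)%R.
Proof.
move=> ig; have icg i : mu.-integrable D (EFin \o (fun y => c i * g i y)).
  rewrite (_ : EFin \o _ = fun y => ((c i)%:E * (EFin \o g i) y)%E)//.
  exact: integrableZl.
elim: n => [|n [ih1 ih2]].
  under eq_Rintegral do rewrite big_ord0.
  rewrite big_ord0 Rintegral_cst// mul0r; split => //.
  rewrite (_ : EFin \o _ = cst 0%E); first exact: integrable0.
  by apply/funext => y /=; rewrite big_ord0.
under eq_Rintegral do rewrite big_ord_recr/=.
rewrite big_ord_recr/= RintegralD// ih2 RintegralZl//; split => //.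
rewrite (_ : EFin \o _ =
    (EFin \o (fun y => \sum_(i < n) c i * g i y)) \+
    (EFin \o (fun y => c n * g n y))).
  exact: integrableD.
by apply/funext => y /=; rewrite big_ord_recr.
Qed.

Lemma expRN_itv {y} : 0 <= y -> 0 <= expR (- y) <= 1.
Proof. by move=> y0; rewrite expR_ge0/= -expR0 ler_expR oppr_le0. Qed.

(** An affine function of [t] is minimal at an end of the unit interval. The same minimum serves
    below as radius of the expansion at [x]. *)
Lemma den_ge {x t} : x < 1 -> 0 <= t <= 1 -> Num.min 1 (1 - x) <= 1 - x * t.
Proof.
move=> x1 /andP[t0 t1]; rewrite ge_min; apply/orP.
by have [x0|x0] := lerP 0 x; [right|left]; nra.
Qed.

Lemma radius_gt0 {x} : x < 1 -> 0 < Num.min 1 (1 - x).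
Proof. by move=> x1; rewrite lt_min ltr01 subr_gt0. Qed.

Lemma measurable_den {x} n : x < 1 ->
  measurable_fun D (fun y => (1 - x * expR (- y)) ^- n).
Proof.
move=> x1.
apply: (eq_measurable_fun (fun y => (1 - x * expR (- y)) `^ (- n%:R))).
  move=> y; rewrite inE/= in_itv/= andbT => /expRN_itv ey.
  by rewrite powR_invn// (le_trans _ (den_ge x1 ey))// ltW// radius_gt0.
rewrite (_ : (fun y => _) =
    (@powR R ^~ (- n%:R)) \o (fun y => 1 - x * expR (- y)))//.
apply: measurableT_comp; first exact: measurable_powR.
apply: measurable_funB => //; apply: measurable_funM => //.
by apply: measurable_funTS; apply: measurableT_comp.
Qed.

Lemma measurable_expRM r : measurable_fun D (fun y => expR (r * y)).
Proof.
by apply: measurable_funTS; apply: measurableT_comp => //.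
Qed.

(** Times ['C(n + k, k)], this is the [n]-th Taylor coefficient in [x] of [expR (s * y) * (1 - x *
    expR (- y)) ^- k.+1]. *)
Definition hyp_kernel s x k n y : R :=
  expR (s * y) * expR (- y) ^+ n * (1 - x * expR (- y)) ^- (k.+1 + n).

Lemma measurable_hyp_kernel s {x} k n : x < 1 ->
  measurable_fun D (hyp_kernel s x k n).
Proof.
move=> x1; apply: measurable_funM; last exact: measurable_den.
apply: measurable_funM; first exact: measurable_expRM.
apply: measurable_funX.
rewrite (_ : (fun y => expR (- y)) = fun y => expR (- 1 * y)).
  exact: measurable_expRM.
by apply/funext => y; rewrite mulN1r.
Qed.

(** One factor [expR (- y)] is spent against the growth of [expR (s * y)], hence the index [n.+1];
    the others are at most 1. *)
Lemma hyp_kernel_le s {x} k n {y} : x < 1 -> 0 <= y ->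
  0 <= hyp_kernel s x k n.+1 y <=
  Num.min 1 (1 - x) ^- (k.+1 + n.+1) * expR (- (1 - s) * y).
Proof.
move=> x1 y0; have ey := expRN_itv y0.
have d0 := radius_gt0 x1; have du := den_ge x1 ey.
have u0 := lt_le_trans d0 du.
rewrite /hyp_kernel exprS mulrA -expRD.
have -> : s * y + - y = - (1 - s) * y by ring.
have e0 : 0 <= expR (- (1 - s) * y) * expR (- y) ^+ n.
  by rewrite mulr_ge0 ?exprn_ge0 ?expR_ge0.
have v0 : 0 <= (1 - x * expR (- y)) ^- (k.+1 + n.+1).
  by rewrite invr_ge0 exprn_ge0// ltW.
rewrite mulr_ge0//= [leRHS]mulrC; apply: ler_pM => //.
  by rewrite -[leRHS]mulr1 ler_wpM2l ?expR_ge0// exprn_ile1//; case/andP: ey.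
by rewrite lef_pV2 ?posrE ?exprn_gt0// lerXn2r// nnegrE ltW.
Qed.

Lemma integrable_hyp_kernel {s x} k n : s < 1 -> x < 1 ->
  mu.-integrable D (EFin \o hyp_kernel s x k n.+1).
Proof.
move=> s1 x1.
apply: (@integrable_le_expR (1 - s) (Num.min 1 (1 - x) ^- (k.+1 + n.+1)) _).
- by rewrite subr_gt0.
- exact: measurable_hyp_kernel.
- move=> y y0; have /andP[h1 h2] := hyp_kernel_le s k n x1 y0.
  by rewrite ger0_norm.
Qed.

(* Euler's integral [1 + s \int_0^1 t^(-s-1) (1 - (1 - x t)^(-k-1)) dt] of
   [2F1(-s, k+1; 1-s; x)], after the substitution [t = exp(-y)]. *)
Definition hyp_integrand s k x y : R :=
  expR (s * y) * ((1 - x * expR (- y)) ^- k.+1 - 1).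

Definition hyp_integral s k x : R :=
  1 - s * (\int[mu]_(y in D) hyp_integrand s k x y)%R.

(** With [u = 1 - x * expR (- y)], the difference [u ^- k.+1 - 1] is divisible by
    [u^-1 - 1 = x * expR (- y) / u], which supplies the decay. *)
Lemma integrable_hyp_integrand {s} k {x} : s < 1 -> x < 1 ->
  mu.-integrable D (EFin \o hyp_integrand s k x).
Proof.
move=> s1 x1; set d := Num.min 1 (1 - x).
have d0 : 0 < d := radius_gt0 x1.
apply: (@integrable_le_expR (1 - s) (`|x| * d^-1 * \sum_(i < k.+1) d ^- i) _).
- by rewrite subr_gt0.
- apply: measurable_funM; first exact: measurable_expRM.
  by apply: measurable_funB => //; exact: measurable_den.
move=> y y0; have ey := expRN_itv y0.
have du : d <= _ := den_ge x1 ey.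
have u0 := lt_le_trans d0 du.
rewrite /hyp_integrand; set t := expR (- y) in ey du u0 *.
set u := 1 - x * t in du u0 *.
rewrite -exprVn subrX1.
have -> : u^-1 - 1 = x * t * u^-1 by rewrite /u; field; rewrite gt_eqF.
have -> : expR (s * y) * (x * t * u^-1 * (\sum_(i < k.+1) u^-1 ^+ i)) =
    expR (- (1 - s) * y) * (x * (u^-1 * (\sum_(i < k.+1) u^-1 ^+ i))).
  have -> : expR (- (1 - s) * y) = expR (s * y) * t.
    by rewrite -expRD; congr expR; ring.
  by ring.
have ud : u^-1 <= d^-1 by rewrite lef_pV2.
rewrite normrM ger0_norm ?expR_ge0// mulrC ler_wpM2r ?expR_ge0//.
rewrite normrM -[leRHS]mulrA ler_wpM2l//.
have s0 : 0 <= \sum_(i < k.+1) u^-1 ^+ i.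
  by apply: sumr_ge0 => i _; rewrite exprn_ge0// invr_ge0 ltW.
rewrite ger0_norm; last by rewrite mulr_ge0// invr_ge0 ltW.
apply: ler_pM => //; first by rewrite invr_ge0 ltW.
apply: ler_sum => i _.
by rewrite -exprVn lerXn2r// nnegrE invr_ge0 ltW.
Qed.
(** Coefficients from differentiation under the integral sign. The constant term is separate: for
    [s >= 0] the kernel of index 0 is not integrable. *)
Definition hyp_taylor s k x n : R :=
  if n is n'.+1 then
    - (s * ('C(n + k, k)%:R * (\int[mu]_(y in D) hyp_kernel s x k n y)%R))
  else hyp_integral s k x.

Lemma hyp_kernel_sumE s {x} k n h {y} : x < 1 -> 0 <= y ->
  \sum_(i < n) 'C(i.+1 + k, k)%:R * h ^+ i.+1 * hyp_kernel s x k i.+1 y =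
  expR (s * y) * (1 - x * expR (- y)) ^- k.+1 *
  (\sum_(i < n.+1) 'C(i + k, k)%:R *
     (h * expR (- y) / (1 - x * expR (- y))) ^+ i - 1).
Proof.
move=> x1 y0; have u0 := lt_le_trans (radius_gt0 x1) (den_ge x1 (expRN_itv y0)).
rewrite big_ord_recl/= add0n binn expr0 mulr1 addrAC subrr add0r mulr_sumr.
apply: eq_bigr => i _; rewrite /hyp_kernel /bump/= add1n.
by rewrite exprD !exprMn exprVn; field; rewrite !expf_neq0 ?gt_eqF.
Qed.

(** The integrand at [x + h] is expanded as a negative binomial series in
    [h * expR (- y) / (1 - x * expR (- y))], then integrated termwise by dominated convergence. *)
Lemma hyp_integral_taylor s k x h : s < 1 -> x < 1 ->
  `|h| < Num.min 1 (1 - x) ->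
  pseries (hyp_taylor s k x) h @ \oo --> hyp_integral s k (x + h).
Proof.
move=> s1 x1 hd; set d := Num.min 1 (1 - x) in hd.
have d0 : 0 < d := radius_gt0 x1.
have xh1 : x + h < 1.
  have : d <= 1 - x by rewrite ge_min lexx orbT.
  by have := ler_norm h; lra.
pose G n y :=
  \sum_(i < n) 'C(i.+1 + k, k)%:R * h ^+ i.+1 * hyp_kernel s x k i.+1 y.
pose g y := expR (s * y) * ((1 - (x + h) * expR (- y)) ^- k.+1 -
                            (1 - x * expR (- y)) ^- k.+1).
have iK i : mu.-integrable D (EFin \o hyp_kernel s x k i.+1).
  exact: integrable_hyp_kernel.
have GS n := Rintegral_sum (n := n)
  (c := fun i => 'C(i.+1 + k, k)%:R * h ^+ i.+1) iK.
(* Bounds the absolute ratio of that series uniformly in [y]. *)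
pose rho := `|h| / d.
have rho01 : 0 <= rho < 1 by rewrite divr_ge0 ?(ltW d0)//= ltr_pdivrMr// mul1r.
have [intg cvgG] : mu.-integrable D (EFin \o g) /\
    (\int[mu]_(y in D) G n y)%R @[n --> \oo] --> (\int[mu]_(y in D) g y)%R.
  apply: (@dominated_Rintegral _ _ R mu D G g
    (fun y => (d ^- k.+1 * (1 - rho) ^- k.+1) * expR (- (1 - s) * y))).
  - exact: measurable_itv.
  - by move=> n; have [/measurable_int/measurable_EFinP] := GS n.
  - move=> y; rewrite /= in_itv/= andbT => y0.
    rewrite /G; under eq_fun do rewrite (hyp_kernel_sumE s k _ h x1 y0).
    have du := den_ge x1 (expRN_itv y0).
    have u0 := lt_le_trans d0 du.
    set t := expR (- y) in du u0 *; set u := 1 - x * t in du u0 *.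
    have gE : g y = expR (s * y) * u ^- k.+1 * ((1 - h * t / u) ^- k.+1 - 1).
      have uht : 1 - (x + h) * t = u * (1 - h * t / u).
        by rewrite mulrBr mulr1 [u * (_ / u)]mulrC divfK ?gt_eqF// /u; ring.
      by rewrite /g -/t uht exprMn invfM; ring.
    rewrite gE; apply: cvgMr; apply: cvgB; last exact: cvg_cst.
    (* The sum in [hyp_kernel_sumE] runs up to [n.+1]. *)
    rewrite (cvg_shiftS
      (fun n => \sum_(i < n) 'C(i + k, k)%:R * (h * t / u) ^+ i)).
    apply: negbin_cvg; rewrite normrM normrV ?unitfE ?gt_eqF// (gtr0_norm u0).
    rewrite ltr_pdivrMr// mul1r (lt_le_trans _ du)// (le_lt_trans _ hd)//.
    rewrite normrM -[leRHS]mulr1 ler_wpM2l// ger0_norm ?expR_ge0//.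
    by have /andP[] := expRN_itv y0.
  - rewrite (_ : EFin \o _ = fun y =>
      ((d ^- k.+1 * (1 - rho) ^- k.+1)%:E * (expR (- (1 - s) * y))%:E)%E)//.
    apply: integrableZl => //.
    by have [] := @integral_expR (1 - s) _; rewrite ?subr_gt0.
  - move=> n y; rewrite /= in_itv/= andbT => y0.
    rewrite /G (le_trans (ler_norm_sum _ _ _))//.
    (* The factor [d ^- i.+1] of the kernel bound turns the power of [h] into one of [rho]. *)
    apply: (@le_trans _ _ (\sum_(i < n) 'C(i.+1 + k, k)%:R * rho ^+ i.+1 *
                         (d ^- k.+1 * expR (- (1 - s) * y)))).
      apply: ler_sum => i _; have /andP[K0 Kle] := hyp_kernel_le s k i x1 y0.
      rewrite normrM (ger0_norm K0) normrM normrX ger0_norm//.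
      rewrite -!mulrA ler_wpM2l//.
      rewrite (le_trans (ler_wpM2l _ Kle)) ?exprn_ge0//.
      rewrite /rho exprMn exprVn exprD invfM -/d le_eqVlt.
      by apply/orP; left; apply/eqP; ring.
    rewrite -mulr_suml -mulrA mulrC -!mulrA ler_wpM2l//.
      by rewrite invr_ge0 exprn_ge0// ltW.
    rewrite mulrC ler_wpM2r ?expR_ge0//.
    have := negbin_sum_le (k := k) (n := n.+1) rho01.
    rewrite big_ord_recl/= add0n binn mul1r expr0; apply: le_trans.
    by rewrite lerDr.
rewrite -cvg_shiftS/=.
have -> : hyp_integral s k (x + h) =
    hyp_integral s k x - s * (\int[mu]_(y in D) g y)%R.
  rewrite /hyp_integral -addrA -opprD -mulrDr -RintegralD//.
    congr (_ - s * _); apply: eq_Rintegral => y _.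
    by rewrite /hyp_integrand /g; ring.
  exact: integrable_hyp_integrand.
rewrite (_ : (fun n => _) =
    fun n => hyp_integral s k x - s * (\int[mu]_(y in D) G n y)%R).
  by apply: cvgB; [exact: cvg_cst|exact: cvgMr].
apply/funext => n.
rewrite /pseries/series/= big_mkord big_ord_recl/= expr0 mulr1.
congr (_ + _); rewrite (GS n).2 mulr_sumr -sumrN; apply: eq_bigr => i _.
by rewrite /bump/= add1n; ring.
Qed.

(** * Expansion at 0 and the Gauss series *)

Lemma hyp_integral0 s k : hyp_integral s k 0 = 1.
Proof.
rewrite /hyp_integral (_ : Rintegral _ _ _ = 0) ?mulr0 ?subr0//.
under eq_Rintegral do
  rewrite /hyp_integrand mul0r subr0 expr1n invr1 subrr mulr0.
by rewrite Rintegral_cst// mul0r.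
Qed.

Lemma risingS (a : R) n : rising a n.+1 = rising a n * (a + n%:R).
Proof. by rewrite /rising big_ord_recr. Qed.

Lemma rising_nat k n : rising (k.+1%:R : R) n = 'C(n + k, k)%:R * n`!%:R.
Proof.
elim: n => [|n ih]; first by rewrite /rising big_ord0 add0n binn fact0 mulr1.
rewrite risingS ih -natrD -!natrM; congr (_%:R).
have factE m : ('C(m + k, k) * m`! * k`! = (m + k)`!)%N.
  by rewrite -(bin_fact (leq_addl m k)) addnK; lia.
have factES : ('C(n.+1 + k, k) * n.+1`! * k`! = (n + k).+1 * (n + k)`!)%N.
  by rewrite factE.
apply/eqP; rewrite -(eqn_pmul2r (fact_gt0 k)) factES -factE.
by rewrite mulnAC mulnC addSn (addnC k).
Qed.

(** Both sides are [rising a n.+1], with the last or the first factor split off. *)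
Lemma rising_shift (a : R) n : rising a n * (a + n%:R) = a * rising (a + 1) n.
Proof.
rewrite -risingS /rising big_ord_recl/= addr0; congr (_ * _).
by apply: eq_bigr => i _; rewrite /bump/= natrD addrA.
Qed.

Lemma rising_gt0 (a : R) n : 0 < a -> 0 < rising a n.
Proof. by move=> a0; apply: prodr_gt0 => i _; rewrite ltr_pwDl. Qed.

(** At [x = 0] the kernel of index [n > 0] is a pure exponential with integral [(n - s)^-1], and the
    ratio of the rising factorials of [- s] and [1 - s] is [- s / (n - s)]. *)
Lemma hyp_taylor0E s k n : 0 < s < 1 ->
  hyp_taylor s k 0 n = hyp2F1_coef (- s) k.+1%:R (1 - s) n.
Proof.
move=> /andP[s0 s1]; rewrite /hyp2F1_coef rising_nat.
have r0 : rising (1 - s) n != 0 by rewrite gt_eqF// rising_gt0// subr_gt0.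
have f0 : n`!%:R != 0 :> R by rewrite pnatr_eq0 -lt0n fact_gt0.
case: n => [|n] in r0 f0 *.
  rewrite /hyp_taylor hyp_integral0 /rising !big_ord0 add0n binn fact0.
  by rewrite !mul1r invr1.
have ns : 0 < n.+1%:R - s by rewrite subr_gt0 (lt_le_trans s1)// ler1n.
rewrite /hyp_taylor.
have -> : (\int[mu]_(y in D) hyp_kernel s 0 k n.+1 y)%R = (n.+1%:R - s)^-1.
  have [_ <-] := integral_expR ns; apply: eq_Rintegral => y _.
  rewrite /hyp_kernel mul0r subr0 expr1n invr1 mulr1 -expRM_natl -expRD.
  by congr expR; ring.
have -> : rising (- s) n.+1 = - s * rising (1 - s) n.+1 / (n.+1%:R - s).
  apply: (mulIf (lt0r_neq0 ns)); rewrite divfK ?gt_eqF//.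
  by rewrite addrC rising_shift [1 - s]addrC.
move: (rising (1 - s) n.+1) r0 ((n.+1)`!%:R : R) f0 => u u0 v v0.
by move: (n.+1%:R - s) ns => w w0; field; rewrite u0 v0 gt_eqF.
Qed.

(** The Gauss series is the expansion at 0, of radius 1; the expansions at the other points give
    analyticity. *)
Lemma is_hyp2F1_hyp_integral {s} k : 0 < s < 1 ->
  is_hyp2F1 (- s) k.+1%:R (1 - s) (hyp_integral s k).
Proof.
move=> s01; have /andP[s0 s1] := s01; split=> [z z1|x x1].
  rewrite -[z in _ --> hyp_integral _ _ z]add0r.
  rewrite (_ : hyp2F1_coef _ _ _ = hyp_taylor s k 0).
    by apply: hyp_integral_taylor => //; rewrite subr0 minxx.
  by apply/funext => n; rewrite hyp_taylor0E.
exists (hyp_taylor s k x); apply/nbhs_ballP.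
exists (Num.min 1 (1 - x)) => [|h]; first exact: radius_gt0.
by rewrite /ball/= sub0r normrN; exact: hyp_integral_taylor.
Qed.

(** For [x <= 0] the denominators are at least 1, so the integrand is nonpositive. *)
Lemma hyp_integral_ge1 s k x : 0 <= s < 1 -> x <= 0 -> 1 <= hyp_integral s k x.
Proof.
move=> /andP[s0 s1] x0; rewrite lerBrDl gerDr mulr_ge0_le0//.
rewrite -oppr_ge0 -mulN1r -RintegralZl//; last first.
  by apply: integrable_hyp_integrand => //; lra.
apply: Rintegral_ge0 => y; rewrite /= in_itv/= andbT => y0.
rewrite mulN1r oppr_ge0 mulr_ge0_le0 ?expR_ge0// subr_le0.
have u1 : 1 <= 1 - x * expR (- y).
  by rewrite lerDl oppr_ge0 mulr_le0_ge0 ?expR_ge0.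
by rewrite invf_le1 ?exprn_ege1// exprn_gt0// (lt_le_trans _ u1).
Qed.

End LaplaceIntegral.

(** * Identity theorem and uniqueness of the continuation *)

Section AnalyticIdentity.
Context {R : realType}.
Implicit Types (a : nat -> R) (h r e : R) (F G H : R -> R) (s x : R) (k : nat).

(** Strong induction: once the lower coefficients vanish, [a n * h ^+ n] is opposite to a tail of
    order [h ^+ n.+1]; divide by [h ^+ n] and let [h] tend to 0. *)
Lemma pseries_coef_eq0 a r e : 0 < r -> 0 < e ->
  cvgn (pseries a r) -> (forall h, 0 < h < e -> pseries a h @ \oo --> 0) ->
  forall n, a n = 0.
Proof.
move=> r0 e0 car ca0.
have [M [Mreal /(_ (`|M| + 1))]] := cvg_series_bounded car.
rewrite (le_lt_trans (ler_norm M)) ?ltrDl// => /(_ isT) aM.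
set K := `|M| + 1 in aM.
have K0 : 0 <= K by rewrite addr_ge0.
have {aM}aM i : `|a i| <= K * r ^- i.
  rewrite ler_pdivlMr ?exprn_gt0//.
  by have /= := aM i I; rewrite normrM normrX (gtr0_norm r0).
elim/ltn_ind => n ih; apply/eqP; rewrite -normr_le0.
(* With [h <= r / 2] the tail is dominated by a geometric series of ratio 1/2 and sum 2; [e / 2]
   keeps [h] strictly below [e]. *)
apply: (@le0_of_small _ _ (K * r ^- n.+1 * 2) (Num.min (r / 2) (e / 2))).
  by rewrite lt_min !divr_gt0.
move=> h /andP[h0]; rewrite le_min => /andP[hr he].
have hr01 : 0 <= h / r <= 2^-1.
  by rewrite divr_ge0 ?(ltW h0) ?(ltW r0)//= ler_pdivrMr// mulrC.
have tail m : `|\sum_(i < n.+1 + m) a i * h ^+ i - a n * h ^+ n| <=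
    K * r ^- n.+1 * 2 * h ^+ n.+1.
  rewrite big_split_ord/= big_ord_recr/= big1 ?add0r; last first.
    by move=> i _; rewrite ih ?mul0r.
  rewrite addrAC subrr add0r (le_trans (ler_norm_sum _ _ _))//.
  apply: (@le_trans _ _
    (\sum_(i < m) K * r ^- n.+1 * h ^+ n.+1 * (h / r) ^+ i)).
    apply: ler_sum => i _; rewrite normrM normrX (gtr0_norm h0).
    apply: (le_trans (ler_wpM2r _ (aM _))); first by rewrite exprn_ge0// ltW.
    rewrite le_eqVlt; apply/orP; left; apply/eqP.
    by rewrite !exprD exprMn exprVn invfM; ring.
  rewrite -mulr_sumr -[leRHS]mulrAC ler_wpM2l//.
    by rewrite mulr_ge0 ?exprn_ge0 ?(ltW h0)// divr_ge0// exprn_ge0// ltW.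
  apply: (@le_trans _ _ (\sum_(i < m) 'C(i + 0, 0)%:R * 2^-1 ^+ i)).
    apply: ler_sum => i _; rewrite bin0 mul1r.
    by rewrite lerXn2r ?nnegrE//; case/andP: hr01.
  apply: (le_trans (negbin_sum_le _)); first by apply/andP; split; lra.
  by rewrite expr1 (_ : 1 - 2^-1 = 2^-1) ?invrK//; lra.
have tail_cvg : `|\sum_(i < n.+1 + m) a i * h ^+ i - a n * h ^+ n| @[m --> \oo]
    --> `|0 - a n * h ^+ n|.
  apply: cvg_norm; apply: cvgB; last exact: cvg_cst.
  have : 0 < h < e by rewrite h0/=; lra.
  move/ca0; rewrite -(cvg_shiftn n.+1)/=; under eq_fun do rewrite addnC.
  by rewrite /pseries/series/=; under eq_fun do rewrite big_mkord.
have : `|0 - a n * h ^+ n| <= K * r ^- n.+1 * 2 * h ^+ n.+1.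
  by apply: (cvgr_to_le tail_cvg); apply: nearW => m; exact: tail.
rewrite sub0r normrN normrM normrX (gtr0_norm h0) (exprS h) mulrA.
by rewrite ler_pM2r ?exprn_gt0.
Qed.

(** Zeros on the right of [x] kill every coefficient, hence [H] also on the left. *)
Lemma analytic_at_eq0 H x e : analytic_at H x -> 0 < e ->
  (forall h, 0 < h < e -> H (x + h) = 0) ->
  exists2 d, 0 < d & forall h, `|h| < d -> H (x + h) = 0.
Proof.
move=> [a /nbhs_ballP[d /= d0 aH]] e0 He; exists d => // h hd.
have {}aH t : `|t| < d -> pseries a t @ \oo --> H (x + t).
  by move=> td; apply: aH; rewrite /ball/= sub0r normrN.
have a0 : forall n, a n = 0.
  apply: (@pseries_coef_eq0 a (d / 2) (Num.min d e)).
  - by rewrite divr_gt0.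
  - by rewrite lt_min d0.
  - apply/cvg_ex; exists (H (x + d / 2)); apply: aH.
    by rewrite gtr0_norm ?divr_gt0//; lra.
  move=> t /andP[t0]; rewrite lt_min => /andP[td te].
  by rewrite -(He t) ?t0//; apply: aH; rewrite gtr0_norm.
have := aH _ hd; rewrite (_ : pseries a h = cst 0).
  by move=> /(cvg_lim (@Rhausdorff R)) <-; rewrite lim_cst//; exact: Rhausdorff.
by apply/funext => n; rewrite /pseries/series/= big1// => i _; rewrite a0 mul0r.
Qed.

Lemma analytic_eq0 H : (forall x, x < 1 -> analytic_at H x) ->
  (forall x, `|x| < 1 -> H x = 0) -> forall x, x < 1 -> H x = 0.
Proof.
move=> aH H0 x x1; have [xN|xN] := ltP (-1) x.
  by apply: H0; rewrite ltr_norml xN.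
apply/eqP; apply: contraT => Hx; exfalso.
(* Leftward continuation, reflected so that a supremum applies: at [- c] the zeros on the right
   spread to the left, past the supremum [c]. *)
pose S := [set y : R | 0 <= y /\ forall z, 0 <= z <= y -> H (- z) = 0].
have Sub y : S y -> y <= - x.
  move=> [y0 Sy]; rewrite leNgt; apply/negP => xy.
  have nx : 0 <= - x <= y by lra.
  by have := Sy _ nx; rewrite opprK => /eqP; rewrite (negbTE Hx).
have Shalf : S 2^-1.
  split => [|z /andP[z0 z1]]; first by lra.
  by apply: H0; rewrite normrN ger0_norm//; lra.
have supS : has_sup S by split; [exists 2^-1|exists (- x) => y /Sub].
pose c := sup S.
have c0 : 2^-1 <= c by apply: ub_le_sup => //; case: supS.
have below z : 0 <= z -> z < c -> H (- z) = 0.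
  move=> z0 zc; have cz : 0 < c - z by rewrite subr_gt0.
  have [y Sy] := sup_adherent cz supS; rewrite -/c subKr => zy.
  by apply: Sy.2; rewrite z0 ltW.
have [|||d d0 Hd] := @analytic_at_eq0 H (- c) c.
- by apply: aH; lra.
- lra.
- move=> h /andP[h0 hc]; rewrite -[- c + h]opprK; apply: below; lra.
have : S (c + d / 2).
  split => [|z /andP[z0 zc]]; first by lra.
  have [zc'|zc'] := ltP z c; first exact: below.
  by rewrite (_ : - z = - c + (c - z)) ?Hd ?ler0_norm; [|lra|lra|ring].
by move=> /(ub_le_sup supS.2); rewrite -/c; lra.
Qed.

Lemma analytic_atB F G x : analytic_at F x -> analytic_at G x ->
  analytic_at (F \- G) x.
Proof.
move=> [a Fa] [b Gb]; exists (a \- b); near=> h.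
rewrite (_ : pseries _ h = pseries a h \- pseries b h).
  by apply: cvgB; near: h.
apply/funext => n; rewrite /pseries/series/= -sumrB.
by apply: eq_bigr => i _; rewrite mulrBl.
Unshelve. all: by end_near. Qed.

Lemma is_hyp2F1_uniq {a b c : R} {F G x} : is_hyp2F1 a b c F ->
  is_hyp2F1 a b c G -> x < 1 -> F x = G x.
Proof.
move=> [Fg Fa] [Gg Ga] x1; apply/eqP; rewrite -subr_eq0; apply/eqP.
apply: (@analytic_eq0 (F \- G)) x1 => y y1.
  by apply: analytic_atB; [exact: Fa|exact: Ga].
apply/eqP; rewrite subr_eq0; apply/eqP.
exact: cvg_unique (Fg y y1) (Gg y y1).
Qed.

(** Euler's integral witnesses that the set defining [hyp2F1] is nonempty; uniqueness carries its
    bound over to the chosen element. *)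
Lemma hyp2F1_ge1 {s} k {x} : 0 < s < 1 -> x <= 0 ->
  1 <= hyp2F1 (- s) k.+1%:R (1 - s) x.
Proof.
move=> s01 x0; have Fi := is_hyp2F1_hyp_integral k s01.
have Hh : is_hyp2F1 (- s) k.+1%:R (1 - s) (hyp2F1 (- s) k.+1%:R (1 - s)).
  by apply: (xgetPex (fun=> 0)); exists (hyp_integral s k).
rewrite (is_hyp2F1_uniq Hh Fi) ?(le_lt_trans x0)//.
by apply: hyp_integral_ge1 => //; case/andP: s01 => /ltW ->.
Qed.

End AnalyticIdentity.

(** * Monotonicity in the densities and powers *)

Lemma zipf_gt0 {R : realType} {N : nat} (delta : R) (f : 'I_N) :
  0 < zipf delta f.
Proof.
by rewrite divr_gt0 ?powR_gt0// (bigD1 f)//= ltr_pwDl ?powR_gt0 ?sumr_ge0.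
Qed.

Lemma zipf_decr (R : realType) (N : nat) (delta : R) (f f' : 'I_N) :
  0 < delta -> (f < f')%N -> zipf delta f' < zipf delta f.
Proof.
move=> d0 ff'; rewrite /zipf ltr_pM2r; last first.
  by rewrite invr_gt0 (bigD1 f)//= ltr_pwDl ?powR_gt0 ?sumr_ge0.
rewrite !powRN ltf_pV2 ?posrE ?powR_gt0//.
by rewrite gt0_ltr_powR ?nnegrE// ltr_nat.
Qed.

Lemma Gamma_ge0 (R : realType) (s : R) : 0 <= Gamma s.
Proof.
by apply: Rintegral_ge0 => t _; rewrite mulr_ge0 ?powR_ge0 ?expR_ge0.
Qed.

Lemma C2_ge0 (R : realType) (alpha gamma0 : R) (M2 : nat) :
  0 <= C2 alpha gamma0 M2.
Proof. by rewrite /C2 !mulr_ge0 ?invr_ge0 ?Gamma_ge0 ?powR_ge0. Qed.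

Section C1.
Context {R : realType} {alpha gamma0 B12 : R} {M1 M2 : nat}.
Hypotheses (alpha_gt2 : 2 < alpha) (gamma0_gt0 : 0 < gamma0)
  (B12_gt0 : 0 < B12) (M1_ge1 : (1 <= M1)%N).

(** As [alpha > 2], the parameter [s = 2 / alpha] lies in ]0, 1[, and the argument is
    nonpositive. *)
Lemma hyp2F1_C1_gt0 : 0 < hyp2F1 (- (2 / alpha)) M1%:R (1 - 2 / alpha)
  (- (gamma0 / (M1%:R / M2%:R * B12))).
Proof.
case: M1 M1_ge1 => // k _; apply: lt_le_trans (hyp2F1_ge1 k _ _) => //.
  have alpha_gt0 : 0 < alpha by rewrite (lt_trans _ alpha_gt2).
  by rewrite divr_gt0//= ltr_pdivrMr// mul1r.
by rewrite oppr_le0 !(divr_ge0, mulr_ge0)// ltW.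
Qed.

Lemma C1_gt0 (l P : R) : 0 < l -> 0 < P ->
  0 < C1 alpha gamma0 B12 M1 M2 l P.
Proof.
move=> l0 P0; rewrite /C1 mulr_gt0 ?hyp2F1_C1_gt0// mulr_gt0//.
by rewrite powR_gt0// mulr_gt0.
Qed.

Lemma C1_lt_lambda (l l' P : R) : 0 < P -> l < l' ->
  C1 alpha gamma0 B12 M1 M2 l P < C1 alpha gamma0 B12 M1 M2 l' P.
Proof.
move=> P0 ll'; rewrite /C1 ltr_pM2r ?hyp2F1_C1_gt0//.
by rewrite ltr_pM2r// powR_gt0// mulr_gt0.
Qed.

Lemma C1_lt_P (l P P' : R) : 0 < l -> 0 < P -> P < P' ->
  C1 alpha gamma0 B12 M1 M2 l P < C1 alpha gamma0 B12 M1 M2 l P'.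
Proof.
move=> l0 P0 PP'; rewrite /C1 ltr_pM2r ?hyp2F1_C1_gt0// ltr_pM2l//.
have alpha_gt0 : 0 < alpha by rewrite (lt_trans _ alpha_gt2).
have P'0 : 0 < P' by exact: lt_trans PP'.
by rewrite gt0_ltr_powR ?divr_gt0 ?nnegrE ?ltr_pM2r// mulr_ge0// ltW.
Qed.

End C1.

Theorem corollary1 (R : realType) (alpha gamma0 B12 delta : R)
    (M1 M2 Nf Nc : nat)
    (halpha : 2 < alpha) (hgamma0 : 0 < gamma0) (hB12 : 0 < B12)
    (hdelta : 0 < delta) (hM1 : (1 <= M1)%N) (hM2 : M2 = 1%N)
    (hNc : (0 < Nc)%N) (hNcf : (Nc <= Nf)%N)
    (* the optimal caching probabilities, as a function of lambda12 and P12 *)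
    (qstar : R -> R -> 'rV[R]_Nf)
    (hqstar : forall lambda12 P12 : R, 0 < lambda12 -> 0 < P12 ->
      optimal_caching Nc alpha gamma0 B12 delta M1 M2 lambda12 P12
        (qstar lambda12 P12))
    (* two consecutive files *)
    (f f' : 'I_Nf) (hf : nat_of_ord f' = (nat_of_ord f).+1) :
  (forall P12 : R, 0 < P12 ->
     {in [set lambda12 : R | 0 < lambda12 /\
            0 < qstar lambda12 P12 0 f < 1 /\
            0 < qstar lambda12 P12 0 f' < 1] &,
       {homo (fun lambda12 : R =>
                qstar lambda12 P12 0 f - qstar lambda12 P12 0 f')
         : x y / x < y}}) /\
  (forall lambda12 : R, 0 < lambda12 ->
     {in [set P12 : R | 0 < P12 /\
            0 < qstar lambda12 P12 0 f < 1 /\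
            0 < qstar lambda12 P12 0 f' < 1] &,
       {homo (fun P12 : R =>
                qstar lambda12 P12 0 f - qstar lambda12 P12 0 f')
         : x y / x < y}}).
Proof.
have qmax l P (l0 : 0 < l) (P0 : 0 < P) : maximizes Nc (zipf delta)
    (C1 alpha gamma0 B12 M1 M2 l P + C2 alpha gamma0 M2)
    (C3 alpha gamma0 M2 + 1) (qstar l P) := hqstar l P l0 P0.
(* The parameters enter only through [C1], so one comparison covers both claims. *)
have gap l l' P P' : 0 < l -> 0 < P -> 0 < l' -> 0 < P' ->
    C1 alpha gamma0 B12 M1 M2 l P < C1 alpha gamma0 B12 M1 M2 l' P' ->
    0 < qstar l P 0 f < 1 -> 0 < qstar l P 0 f' < 1 ->
    0 < qstar l' P' 0 f < 1 -> 0 < qstar l' P' 0 f' < 1 ->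
    qstar l P 0 f - qstar l P 0 f' < qstar l' P' 0 f - qstar l' P' 0 f'.
  move=> l0 P0 l'0 P'0 C1lt.
  have A0 : 0 < C1 alpha gamma0 B12 M1 M2 l P + C2 alpha gamma0 M2.
    by rewrite ltr_pwDl ?C2_ge0// C1_gt0.
  have AA' : C1 alpha gamma0 B12 M1 M2 l P + C2 alpha gamma0 M2 <
      C1 alpha gamma0 B12 M1 M2 l' P' + C2 alpha gamma0 M2 by rewrite ltrD2r.
  have pff' : zipf delta f' < zipf delta f by apply: zipf_decr; rewrite ?hf.
  exact: (maximizes_gap_lt (zipf_gt0 delta) hNc A0 AA' pff'
    (qmax l P l0 P0) (qmax l' P' l'0 P'0)).
split=> [P P0 l l'|l l0 P P']; rewrite !inE/= =>
  -[x0 [xf xf']] [y0 [yf yf']] xy; apply: gap => //; first exact: C1_lt_lambda.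
exact: C1_lt_P.
Qed.
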